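(* Let $\beta\in(1,2]$ be a multinacci number. Then $$\dim_H(\mathcal E_\beta\cap[t,1])=\dim_H K_\beta(t)\qquad\text{for all } t\in[0,1).$$
   Context: For $\beta\in(1,2]$ let $T_\beta:[0,1)\to[0,1)$, $T_\beta(x)=\beta x \pmod 1$. For $t\in[0,1)$ let $$K_\beta(t)=\{x\in[0,1): T_\beta^n(x)\ge t\ \text{ for all } n\ge 0\}.$$ $\dim_H$ denotes Hausdorff dimension, with $\dim_H\emptyset=0$. The set-valued bifurcation set is $$\mathcal E_\beta=\{t\in[0,1): K_\beta(t')\neq K_\beta(t)\ \text{ for all } t'\in(t,1)\}.$$ A number $\beta$ is multinacci if for some integer $m\ge1$ it is the unique root in $(1,2)$ of $x^{m+1}=x^m+x^{m-1}+\cdots+x+1$. *)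

(* Defs.v *)
From HB Require Import structures.
From mathcomp Require Import all_boot all_order all_algebra.
From mathcomp Require Import all_classical all_reals all_analysis.

Set Implicit Arguments.
Unset Strict Implicit.
Unset Printing Implicit Defensive.

Import Order.TTheory GRing.Theory Num.Theory.
Import numFieldNormedType.Exports.

Local Open Scope classical_set_scope.
Local Open Scope ring_scope.

(** ** Hausdorff dimension of subsets of the real line *)

(* [ereal_sup set0 = -oo], hence the [maxe 0]: the empty set has diameter 0. *)
Definition diameter (R : realType) (A : set R) : \bar R :=
  maxe 0%E (ereal_sup [set `|x - y|%:E | x in A & y in A]).

(* Since [0 `^ 0 = 1], the case distinction only matters for [s = 0]: an empty
   covering set contributes nothing, so that countable covers include the
   finite ones and the 0-dimensional measure is the counting measure. *)
Definition hausdorff_gauge (R : realType) (s : R) (A : set R) : \bar R :=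
  if A == set0 then 0%E else poweR (diameter A) s.

Definition delta_cover (R : realType) (delta : R) (A : set R)
    (U : nat -> set R) : Prop :=
  A `<=` \bigcup_k U k /\ forall k, (diameter (U k) <= delta%:E)%E.

Definition hausdorff_premeasure (R : realType) (s delta : R) (A : set R)
    : \bar R :=
  ereal_inf [set (\sum_(0 <= k <oo) hausdorff_gauge s (U k))%E
            | U in delta_cover delta A].

Definition hausdorff_measure (R : realType) (s : R) (A : set R) : \bar R :=
  ereal_sup [set hausdorff_premeasure s delta A
            | delta in [set d : R | 0 < d]].

Definition hausdorff_dim (R : realType) (A : set R) : \bar R :=
  ereal_inf [set s%:E
            | s in [set s : R | 0 <= s /\ hausdorff_measure s A = 0%E]].

(** ** The beta-transformation with a hole [[0, t)] *)

(* A total function on [R]; it maps [[0, 1)] into itself. *)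
Definition beta_map (R : realType) (beta x : R) : R :=
  beta * x - (Num.floor (beta * x))%:~R.

Definition survivor_set (R : realType) (beta t : R) : set R :=
  [set x | 0 <= x < 1 /\ forall n : nat, t <= iter n (beta_map beta) x].

Definition bifurcation_set (R : realType) (beta : R) : set R :=
  [set t | 0 <= t < 1 /\
    forall t', t < t' < 1 -> survivor_set beta t' <> survivor_set beta t].

(* [unique P x] states [P x] and that every [x'] satisfying [P] equals [x]. *)
Definition multinacci (R : realType) (beta : R) : Prop :=
  exists2 m : nat, (1 <= m)%N &
    unique (fun x : R => 1 < x < 2 /\ x ^+ m.+1 = \sum_(i < m.+1) x ^+ i) beta.

(* Main.v *)
(* The bifurcation set is the set of [s] whose orbit never goes below [s], which
   gives one inequality. For the other one, let [p] be the least point of the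
   survivor set [K] at [t] and [b] its digit sequence, so that all shifts of the
   digit sequences of points of [K] are lexicographically at least [b]. Each time
   a prefix [b_0 ... b_q] ending in [0] is completed in such a sequence, insert a
   [1] before that last [0]. All shifts of the result exceed [b_0 ... b_q]
   strictly, so that after prefixing it with [b_0 ... b_(r-1) 1], where [r > q]
   and [b_r = 0], one gets the expansion of a point of the bifurcation set above
   [t]. Two insertions are more than [q] digits apart, hence for large [q] the
   map loses an arbitrarily small proportion of digits and is at most
   [exp (o(1) n)]-to-one on words of length [n]; since moreover points with
   different [n]-th words are at distance at least a constant times [beta^-n],
   covers of the bifurcation set pull back to covers of [K]. For a multinacci
   [beta], the root for [m], the admissible sequences are those without [m.+1]
   consecutive ones that do not end in [(1^m 0)^oo]. *)
Require Import Defs.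
From HB Require Import structures.
From mathcomp Require Import all_boot all_order all_algebra.
From mathcomp Require Import zify ring lra.
From mathcomp Require Import all_classical all_reals all_analysis.

Set Implicit Arguments.
Unset Strict Implicit.
Unset Printing Implicit Defensive.

Import Order.TTheory GRing.Theory Num.Theory.
Import numFieldNormedType.Exports.

Local Open Scope classical_set_scope.
Local Open Scope ring_scope.

(** * Binary sequences and the recoding map *)

Section Symbolic.
Local Open Scope nat_scope.
Implicit Types (a b c g x s : nat -> bool) (m n q k : nat).

Definition shift k a : nat -> bool := fun j => a (k + j).

(** Asking for the implication after every common prefix, instead of at a first difference, includes
    the case of equality. *)
Definition lexle a s := forall n, (forall k, k < n -> a k = s k) -> a n -> s n.

Definition no_run m a := forall n, exists2 k, n <= k <= n + m & a k = false.

(* For a sequence without [m.+1] consecutive ones, this says that it does not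
   end in [(1^m 0)^oo], in which zeros are at distance [m.+1]. *)
Definition close_zeros m a := forall n,
  exists k d, [/\ n <= k, 0 < d <= m, a k = false & a (k + d) = false].

(** With [g := shift n a] this inserts a 1 before digit [n]; with a recoded [g] it attaches the
    prefix of the final code. *)
Definition splice n a g : nat -> bool :=
  fun k => if k < n then a k else if k == n then true else g (k - n.+1).

Lemma splice_lt n a g k : k < n -> splice n a g k = a k.
Proof. by rewrite /splice => ->. Qed.

Lemma splice_at n a g : splice n a g n = true.
Proof. by rewrite /splice ltnn eqxx. Qed.

Lemma splice_gt n a g k : splice n a g (n.+1 + k) = g k.
Proof.
rewrite /splice ifF; last lia.
by rewrite ifF; [congr g; lia | lia].
Qed.

(** The new 1 lies between a zero of [a] at most [m] places before it and the zero [g 0] right after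
    it; any window of [m.+1] digits through it meets one of them. *)
Lemma no_run_splice m n a g : no_run m a -> no_run m g -> g 0 = false ->
  (exists2 z, n - m <= z < n & a z = false) -> no_run m (splice n a g).
Proof.
move=> ha hg g0 [z hz az] k.
have [kn|kn] := ltnP n k.
  have [i hi gi] := hg (k - n.+1).
  by exists (n.+1 + i); [lia | rewrite splice_gt].
have [kz|kz] := ltnP z k.
  exists (n.+1 + 0); [lia | by rewrite splice_gt].
have [km|km] := ltnP (k + m) n.
  have [i hi ai] := ha k.
  by exists i => //; rewrite splice_lt //; lia.
by exists z; [lia | rewrite splice_lt //; lia].
Qed.

Lemma close_zeros_splice m n a g : close_zeros m g -> close_zeros m (splice n a g).
Proof.
move=> hg N; have [k [d [hk hd gk gd]]] := hg N.
exists (n.+1 + k), d; split => //; first lia.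
  by rewrite splice_gt.
by rewrite -addnA splice_gt.
Qed.

Lemma no_run_first_zero m a : no_run m a ->
  exists i, [/\ (i <= m), forall k, (k < i) -> a k & a i = false].
Proof.
move=> /(_ 0)[k hk ak].
have ex : exists i, ~~ a i by exists k; rewrite ak.
case: (ex_minnP ex) => i ai hi; exists i; split.
- by have := hi k; rewrite ak => /(_ erefl); lia.
- by move=> j ji; apply/negPn/negP => /hi; lia.
- exact: negbTE.
Qed.

Lemma close_zeros_shift m n a : close_zeros m a -> close_zeros m (shift n a).
Proof.
move=> ha N; have [k [d [hk hd gk gd]]] := ha (n + N).
exists (k - n), d; rewrite /shift; split => //; first lia.
  by rewrite subnKC //; lia.
by rewrite addnA subnKC //; lia.
Qed.

Lemma no_run_shift m n a : no_run m a -> no_run m (shift n a).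
Proof.
move=> ha N; have [k hk ak] := ha (n + N).
by exists (k - n); [lia | rewrite /shift subnKC //; lia].
Qed.

(* Raising the digit [0] at position [n] to [1] makes every shift that starts
   at or before [n] strictly larger. *)
Lemma lexle_splice b c g n k : lexle b (shift k c) -> c n = false -> k <= n ->
  lexle b (shift k (splice n c g)) /\
  exists2 j, j <= n - k & shift k (splice n c g) j <> b j.
Proof.
move=> hb cn kn.
have E j : k + j < n -> shift k (splice n c g) j = shift k c j.
  by move=> h; rewrite /shift splice_lt.
have D : ~ (forall j, j <= n - k -> b j = shift k (splice n c g) j).
  move=> H; suff: shift k c (n - k) by rewrite /shift subnKC // cn.
  apply: hb => [j hj|]; last by rewrite H // /shift subnKC // splice_at.
  by rewrite H ?E //; lia.
split; last first.
  case: (boolP (all (fun j => b j == shift k (splice n c g) j) (iota 0 (n - k).+1))).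
    move/allP => H; exfalso; apply: D => j hj; apply/eqP/H.
    by rewrite mem_iota; lia.
  move/allPn => [j]; rewrite mem_iota => hj /eqP hne.
  by exists j; [lia | exact: nesym].
move=> j hj bj.
have [h|h] := ltnP (k + j) n.
  rewrite E //; apply: hb => // i hi; rewrite hj // E //; lia.
have [h'|h'] := ltnP n (k + j).
  by exfalso; apply: D => i hi; apply: hj; lia.
by rewrite /shift (_ : k + j = n) ?splice_at //; lia.
Qed.

(** The comparison of [s] with [b] is decided before position [q], and up to there [a] agrees with
    [b]. *)
Lemma lexle_prefix_trans b a s q : lexle b s -> (exists2 j, j < q & s j <> b j) ->
  (forall j, j < q -> a j = b j) -> lexle a s.
Proof.
move=> hb [j0 hj0 ne] hab n hn an.
have [h|h] := ltnP n q.
  apply: hb; last by rewrite -hab.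
  by move=> k hk; rewrite -hab ?hn //; lia.
by exfalso; apply: ne; rewrite -hab // hn //; lia.
Qed.

(** * Insertion of ones so as to avoid a prefix of [b] *)

Section Recode.
Variables (q : nat) (b : nat -> bool).

Definition completes c n :=
  (q <= n) && all (fun j => c (n - q + j) == b j) (iota 0 q.+1).

Lemma completesP c n : reflect (q <= n /\ forall j, j <= q -> c (n - q + j) = b j)
  (completes c n).
Proof.
apply: (iffP andP) => -[qn H]; split => //.
  by move=> j hj; apply/eqP; move/allP: H; apply; rewrite mem_iota; lia.
by apply/allP => j; rewrite mem_iota => hj; rewrite H //; lia.
Qed.

(* [scan x n] is [x] after the insertions made while reading the first [n]
   output digits: each time [b 0, ..., b q] is completed, a [1] is inserted
   before its last digit. *)
Fixpoint scan x n : nat -> bool :=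
  if n is n'.+1 then
    let c := scan x n' in
    if completes c n' then splice n' c (shift n' c) else c
  else x.

Definition recode x : nat -> bool := fun n => scan x n.+1 n.

Lemma scan_stable x n n' k : k < n -> n <= n' -> scan x n' k = scan x n k.
Proof.
move=> kn /subnKC <-; elim: (n' - n) => [|i IH]; first by rewrite addn0.
rewrite addnS /=; case: ifP => _ //.
by rewrite splice_lt //; lia.
Qed.

Lemma recodeE x n k : k < n -> recode x k = scan x n k.
Proof. by move=> kn; rewrite /recode (@scan_stable x k.+1 n k) //. Qed.

Hypothesis bq : b q = false.

Lemma completes_at c n : completes c n -> c n = false.
Proof. by case/completesP => qn /(_ q (leqnn _)); rewrite subnK // bq. Qed.

(** An insertion raises the shifts that start at or before it; a later shift is a shift, by one
    less, of the sequence before the insertion. *)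
Lemma scan_lexle x n : (forall k, lexle b (shift k x)) ->
  forall k, lexle b (shift k (scan x n)).
Proof.
move=> hx; elim: n => [//|n IH] k /=.
case: ifP => // hc.
have [kn|kn] := leqP k n.
  by have [] := lexle_splice (shift n (scan x n)) (IH k) (completes_at hc) kn.
move=> j; have E i : shift k (splice n (scan x n) (shift n (scan x n))) i =
    shift k.-1 (scan x n) i.
  rewrite /shift (_ : k + i = n.+1 + (k.-1 - n + i)) ?splice_gt; last lia.
  by congr scan; lia.
by rewrite E => hj; apply: IH => i hi; rewrite hj // E.
Qed.

Lemma recode_lexle x : (forall k, lexle b (shift k x)) ->
  forall k, lexle b (shift k (recode x)).
Proof.
move=> hx k j hj bj.
have E i : i <= j -> shift k (recode x) i = shift k (scan x (k + j).+1) i.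
  by move=> hi; rewrite /shift (@recodeE x (k + j).+1) //; lia.
rewrite E //; apply: scan_lexle => // i hi.
by rewrite hj // E //; lia.
Qed.

(** An occurrence ending at [k + q] would be completed at stage [k + q], which writes a 1 on its
    last place, where [b q] demands a 0. *)
Lemma recode_avoids x k : exists2 j, j <= q & shift k (recode x) j <> b j.
Proof.
case: (boolP (all (fun j => shift k (recode x) j == b j) (iota 0 q.+1))); last first.
  move/allPn => [j]; rewrite mem_iota => hj /eqP ?.
  by exists j; first lia.
move/allP => H; exfalso.
have {}H j : j <= q -> scan x (k + q).+1 (k + j) = b j.
  move=> hj; rewrite -recodeE; last lia.
  by apply/eqP/H; rewrite mem_iota; lia.
have := H q (leqnn _); rewrite bq /=.
have [_|hn _] := boolP (completes _ _); first by rewrite splice_at.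
have S : scan x (k + q).+1 = scan x (k + q) by rewrite /= (negbTE hn).
move/negP: hn; apply; apply/completesP; split=> [|j hj]; first lia.
by rewrite addnK -S H.
Qed.

(* A completed copy of [b 0, ..., b q] cannot overlap an inserted [1], because
   every window through that [1] has become larger than the prefix of [b]. *)
Lemma completes_gap x n n' : (forall k, lexle b (shift k x)) ->
  completes (scan x n') n' -> n < n' -> n' <= n + q -> ~~ completes (scan x n) n.
Proof.
move=> hx /completesP[qn' H] nn' n'q; apply/negP => hc.
have [] := lexle_splice (shift n (scan x n)) (@scan_lexle x n hx (n' - q))
  (completes_at hc); first lia.
move=> _ [j hj]; apply.
rewrite -H; last lia.
rewrite (@scan_stable x n.+1) //=; last lia.
by rewrite hc.
Qed.

Lemma scan_no_run m x n : (exists2 z, q - m <= z < q & b z = false) ->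
  no_run m x -> no_run m (scan x n).
Proof.
move=> [z hz bz] hx; elim: n => //= n IH; case: ifP => // hc.
apply: no_run_splice => //.
- exact: no_run_shift.
- by rewrite /shift addn0 completes_at.
- case/completesP: hc => qn H; exists (n - q + z); first lia.
  by rewrite H //; lia.
Qed.

Lemma recode_no_run m x : (exists2 z, q - m <= z < q & b z = false) ->
  no_run m x -> no_run m (recode x).
Proof.
move=> hz hx n; have [k hk ck] := @scan_no_run m x (n + m).+1 hz hx n.
by exists k => //; rewrite (@recodeE x (n + m).+1) //; lia.
Qed.

(** Either some completion occurs from stage [N + q] on, and the copied prefix contains the close
    zeros of [b], or the scan no longer changes and keeps those it has inherited from [x]. *)
Lemma recode_close_zeros m x :
  (exists k d, [/\ 0 < d <= m, k + d < q, b k = false & b (k + d) = false]) ->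
  close_zeros m x -> close_zeros m (recode x).
Proof.
move=> [k [d [hd kdq bk bd]]] hx.
have hs n : close_zeros m (scan x n).
  elim: n => //= n IH; case: ifP => // _.
  exact/close_zeros_splice/close_zeros_shift.
move=> N.
have [[n Nn hc]|no] := pselect (exists2 n, N + q <= n & completes (scan x n) n).
  have R j : j < q -> recode x (n - q + j) = b j.
    move=> hj; case/completesP: hc => qn H.
    by rewrite (@recodeE x n) ?H //; lia.
  exists (n - q + k), d; split => //; first lia.
    by rewrite R //; lia.
  by rewrite -addnA R.
have E n : N + q <= n -> scan x n = scan x (N + q).
  move/subnKC <-; elim: (n - _) => [|i IH]; first by rewrite addn0.
  rewrite addnS /= IH ifF //; apply/negP => h; apply: no.
  by exists (N + q + i); [lia | rewrite IH].
have [i [e [hi he xi xe]]] := hs (N + q) N.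
exists i, e; split => //.
  by rewrite (@recodeE x (i + N + q).+1) ?E //; lia.
by rewrite (@recodeE x (i + e + N + q).+1) ?E //; lia.
Qed.

Lemma recode0 x : 0 < q -> recode x 0 = x 0.
Proof. by move=> q0; rewrite /recode /= ifF //; apply/negbTE/completesP => -[]; lia. Qed.

End Recode.

(* Positions where [recode] may insert a [1] without creating [m.+1]
   consecutive ones, and such that each copy of the prefix brings along a pair
   of close zeros. *)
Lemma close_zeros_position m a Q : close_zeros m a -> exists q, [/\ Q <= q, 0 < q,
  a q = false, exists2 z, q - m <= z < q & a z = false &
  exists k d, [/\ 0 < d <= m, k + d < q, a k = false & a (k + d) = false]].
Proof.
move=> ha; have [k [d [_ hd ak ad]]] := ha 0.
have [k' [d' [hk hd' ak' ad']]] := ha (maxn Q (k + d).+1).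
have [? ?] : (k' + d' > k + d) /\ (Q <= k' + d') by lia.
exists (k' + d'); split => //; first by lia.
- by exists k' => //; lia.
- by exists k, d.
Qed.

Section Minimal.
Variables (q r : nat) (b x : nat -> bool).
Hypotheses (hb : forall k, lexle b (shift k b)) (hx : forall k, lexle b (shift k x)).
Hypotheses (bq : b q = false) (br : b r = false) (qr : q < r).

(** A shift starting in the prefix is lifted strictly above [b] by the 1 at position [r]; one
    starting later lies in the recoded part, which avoids [b 0, ..., b q]. Both comparisons are
    settled before the prefix of the code departs from [b]. *)
Lemma splice_recode_lexle n :
  lexle (splice r b (recode q b x)) (shift n (splice r b (recode q b x))).
Proof.
case: n => [|n]; first by move=> j _; rewrite /shift.
have [nr|nr] := ltnP n r.
  have [h [j hj ne]] := lexle_splice (recode q b x) (@hb n.+1) br nr.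
  apply: (lexle_prefix_trans (q := r) h); last by move=> i hi; rewrite splice_lt.
  by exists j => //; lia.
have E i : shift n.+1 (splice r b (recode q b x)) i = shift (n - r) (recode q b x) i.
  by rewrite /shift (_ : n.+1 + i = r.+1 + (n - r + i)) ?splice_gt //; lia.
have [j hj ne] := recode_avoids bq x (n - r).
apply: (@lexle_prefix_trans b _ _ r).
- move=> k hk; rewrite E; apply: (recode_lexle bq hx) => i hi.
  by rewrite hk // E.
- by exists j; [lia | rewrite E].
- by move=> i hi; rewrite splice_lt.
Qed.
End Minimal.

End Symbolic.

Definition starts_with (u : seq bool) (x : nat -> bool) :=
  forall k, (k < size u)%N -> x k = nth false u k.

Lemma starts_with_cat u w x : starts_with u x ->
  (forall k, (k < size w)%N -> x (size u + k)%N = nth false w k) ->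
  starts_with (u ++ w) x.
Proof.
move=> hu hw k; rewrite size_cat nth_cat => hk.
case: ltnP => h; first exact: hu.
by rewrite -hw ?subnKC //; lia.
Qed.

(* The last digit of the output is either a copied digit, or an inserted one,
   and in the latter case the [q] digits before it are [b 0, ..., b q.-1] and
   were copied: this gives the recursion on the number of preimages. *)
Lemma recode_preimages (R : realFieldType) (q : nat) (b : nat -> bool) (z rho : R) :
  b q = false -> 0 <= z -> 0 <= rho -> z * rho ^+ q + z ^+ q <= rho ^+ q.+1 ->
  z <= rho ->
  forall n (v : nat -> bool), exists L : seq (seq bool),
    \sum_(u <- L) z ^+ size u <= rho ^+ n /\
    forall x, (forall k, lexle b (shift k x)) ->
      (forall k, (k < n)%N -> recode q b x k = v k) ->
      exists2 u, u \in L & starts_with u x /\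
        forall k, scan q b x n (n + k) = x (size u + k)%N.
Proof.
move=> bq z0 rho0 hz zrho; elim/ltn_ind => -[_ v|n IH v].
  exists [:: [::]]; rewrite big_seq1 !expr0; split=> // x _ _.
  by exists [::].
have [L1 [s1 h1]] := IH n (ltnSn n) v.
have step x : (forall k, lexle b (shift k x)) ->
    (forall k, (k < n.+1)%N -> recode q b x k = v k) ->
    ~~ completes q b (scan q b x n) n ->
    exists2 u, u \in [seq rcons u (v n) | u <- L1] & starts_with u x /\
        forall k, scan q b x n.+1 (n.+1 + k) = x (size u + k)%N.
  move=> hx hv hc; have [|u uL [ux us]] := h1 x hx.
    by move=> k hk; apply: hv; lia.
  have S : scan q b x n.+1 = scan q b x n by rewrite /= (negbTE hc).
  exists (rcons u (v n)); first exact: map_f.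
  split; last first.
    by move=> k; rewrite S size_rcons addSnnS us; congr x; lia.
  rewrite -cats1; apply: starts_with_cat => // -[|//] _ /=.
  by rewrite -us -hv // addn0 /recode S.
have sL1 : \sum_(u <- [seq rcons u (v n) | u <- L1]) z ^+ size u <= z * rho ^+ n.
  rewrite big_map (eq_bigr (fun u => z * z ^+ size u)).
    by rewrite -mulr_sumr ler_wpM2l.
  by move=> u _; rewrite size_rcons exprS.
have [qn|qn] := leqP q n; last first.
  exists [seq rcons u (v n) | u <- L1]; split.
    by rewrite (le_trans sL1) // exprS ler_wpM2r // exprn_ge0.
  move=> x hx hv; apply: step => //.
  by apply/negP => /completesP []; lia.
(* An inserted 1 consumes no input digit, so in this case words grow by only [q] letters while the
   output grows by [q.+1]. *)
have [|L0 [s0 h0]] := IH (n - q)%N _ v; first lia.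
exists ([seq rcons u (v n) | u <- L1] ++ [seq u ++ mkseq b q | u <- L0]); split.
  rewrite big_cat /= !big_map; have sL0 :
    \sum_(u <- L0) z ^+ size (u ++ mkseq b q) <= z ^+ q * rho ^+ (n - q).
    rewrite (eq_bigr (fun u => z ^+ q * z ^+ size u)).
      by rewrite -mulr_sumr ler_wpM2l // exprn_ge0.
    by move=> u _; rewrite size_cat size_mkseq exprD mulrC.
  have := lerD sL1 sL0; rewrite big_map => /le_trans; apply.
  have -> : n.+1 = (q.+1 + (n - q))%N by lia.
  rewrite {1}(_ : n = (q + (n - q))%N); last lia.
  rewrite !exprD mulrA -mulrDl ler_wpM2r // exprn_ge0 //.
move=> x hx hv; have [hc|hc] := boolP (completes q b (scan q b x n) n); last first.
  by have [u uL hu] := step x hx hv hc; exists u => //; rewrite mem_cat uL.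
have stable i : (i <= q)%N -> scan q b x (n - q + i) = scan q b x (n - q).
  elim: i => [|i IHi] hi; first by rewrite addn0.
  have : ~~ completes q b (scan q b x (n - q + i)) (n - q + i).
    by apply: (completes_gap bq hx hc); lia.
  by rewrite addnS /= => /negbTE ->; apply: IHi; lia.
have {stable} S : scan q b x n = scan q b x (n - q).
  by rewrite -{1}(subnK qn) stable.
have [|u uL [ux us]] := h0 x hx.
  by move=> k hk; apply: hv; lia.
exists (u ++ mkseq b q).
  by rewrite mem_cat; apply/orP; right; exact: map_f.
split.
  apply: starts_with_cat => // k; rewrite size_mkseq => hk.
  rewrite nth_mkseq // -us -S; case/completesP: hc => _ ->//; lia.
move=> k; rewrite /= hc splice_gt /shift S size_cat size_mkseq -addnA -us.
by congr (scan _ _ _ _ _); lia.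
Qed.

(** * Hausdorff measure, content and dimension *)

Section HausdorffContent.
Variable R : realType.
Implicit Types (A B U : set R) (s d : R).
Local Open Scope ereal_scope.

Lemma diameter_ge0 A : 0 <= diameter A.
Proof. by rewrite /diameter le_max lexx. Qed.

Lemma le_diameter A x y : A x -> A y -> `|x - y|%:E <= diameter A.
Proof.
move=> Ax Ay; rewrite /diameter le_max; apply/orP; right.
by apply: ereal_sup_ubound; exists x => //; exists y.
Qed.

Lemma diameter_le A d : (0 <= d)%R ->
  (forall x y, A x -> A y -> (`|x - y| <= d)%R) -> diameter A <= d%:E.
Proof.
move=> d0 h; rewrite /diameter ge_max lee_fin d0 /=; apply: ge_ereal_sup.
by move=> _ [x Ax [y Ay <-]]; rewrite lee_fin h.
Qed.

Lemma hausdorff_gauge0 s : hausdorff_gauge s (@set0 R) = 0.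
Proof. by rewrite /hausdorff_gauge eqxx. Qed.

Lemma hausdorff_gauge_ge0 s A : 0 <= hausdorff_gauge s A.
Proof. by rewrite /hausdorff_gauge; case: ifP => // _; exact: poweR_ge0. Qed.

Lemma hausdorff_gauge_le s A d : (0 <= s)%R -> diameter A <= d%:E ->
  hausdorff_gauge s A <= (d `^ s)%:E.
Proof.
move=> s0 Ad; rewrite /hausdorff_gauge; case: ifP => _.
  by rewrite lee_fin powR_ge0.
rewrite -poweR_EFin; apply: gt0_ler_poweR => //.
- by rewrite in_itv /= diameter_ge0 leey.
- by rewrite in_itv /= leey (le_trans (diameter_ge0 A)).
Qed.

(* The Hausdorff content is the outer measure generated by the gauge when
   every set is declared measurable. *)
Definition hausdorff_content s : set R -> \bar R :=
  mu_ext (hausdorff_gauge s : set (g_sigma_algebraType [set: set R]) -> \bar R).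

Lemma hausdorff_content_le s A (U : nat -> set R) : A `<=` \bigcup_k U k ->
  hausdorff_content s A <= \sum_(0 <= k <oo) hausdorff_gauge s (U k).
Proof.
move=> AU; apply: ereal_inf_lbound; exists U => //; split=> // i.
exact: sub_sigma_algebra.
Qed.

HB.instance Definition _ s := isOuterMeasure.Build R R (hausdorff_content s)
  (@mu_ext0 _ (g_sigma_algebraType [set: set R]) _ _
    (hausdorff_gauge0 s) (hausdorff_gauge_ge0 s))
  (@mu_ext_ge0 _ (g_sigma_algebraType [set: set R]) _ _ (hausdorff_gauge_ge0 s))
  (@le_mu_ext _ (g_sigma_algebraType [set: set R]) _ _)
  (@mu_ext_sigma_subadditive _ (g_sigma_algebraType [set: set R]) _ _
    (hausdorff_gauge_ge0 s)).

Lemma hausdorff_content_le_gauge s A : hausdorff_content s A <= hausdorff_gauge s A.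
Proof.
apply: (le_trans (@hausdorff_content_le s A (fun k => if k == 0%N then A else set0) _)).
  by move=> x Ax; exists 0%N.
rewrite nneseries_recl //=; last by move=> k _; exact: hausdorff_gauge_ge0.
by rewrite eseries0 ?adde0 // => -[//|i] _ _; rewrite hausdorff_gauge0.
Qed.

Lemma hausdorff_content_seq s (I : eqType) (L : seq I) (V : I -> set R) A :
  (forall x, A x -> exists2 u, u \in L & V u x) ->
  hausdorff_content s A <= \sum_(u <- L) hausdorff_gauge s (V u).
Proof.
elim: L A => [|u L IH] A h.
  rewrite big_nil (_ : A = set0) ?outer_measure0 //.
  by apply/seteqP; split=> // x /h[].
rewrite big_cons; apply: (@le_trans _ _ (hausdorff_content s (V u `|` (A `\` V u)))).
  apply: le_outer_measure => x Ax.
  by have [|] := pselect (V u x); [left | right].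
apply: (le_trans (outer_measureU2 _ _ _)); apply: leeD.
  exact: hausdorff_content_le_gauge.
apply: IH => x [Ax nVx]; have [w] := h x Ax.
rewrite inE => /orP[/eqP ->//|wL Vw]; by exists w.
Qed.

Lemma delta_cover_null s A d e : hausdorff_measure s A = 0 -> (0 < d)%R -> (0 < e)%R ->
  exists2 U : nat -> set R, delta_cover d A U &
    \sum_(0 <= k <oo) hausdorff_gauge s (U k) <= e%:E.
Proof.
move=> h d0 e0.
have p0 : hausdorff_premeasure s d A <= 0.
  by rewrite -h; apply: ereal_sup_ubound; exists d.
have pe : hausdorff_premeasure s d A = 0.
  apply/eqP; rewrite eq_le p0 /=; apply: le_ereal_inf_tmp => _ [U _ <-].
  by apply: nneseries_ge0 => k _ _; exact: hausdorff_gauge_ge0.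
have [|_ [U hU <-]] := @lb_ereal_inf_adherent _ [set (\sum_(0 <= k <oo) hausdorff_gauge s (U k))
            | U in delta_cover d A] e e0.
  by rewrite -/(hausdorff_premeasure s d A) pe.
rewrite -/(hausdorff_premeasure s d A) pe add0e => /ltW hle.
by exists U.
Qed.

Lemma hausdorff_measure_ge0 s A : 0 <= hausdorff_measure s A.
Proof.
apply: ereal_sup_ge; exists (hausdorff_premeasure s 1 A); first by exists 1%R => //=.
apply: le_ereal_inf_tmp => _ [U _ <-].
by apply: nneseries_ge0 => k _ _; exact: hausdorff_gauge_ge0.
Qed.

Lemma hausdorff_measure_null s A : (0 < s)%R -> hausdorff_content s A = 0 ->
  hausdorff_measure s A = 0.
Proof.
move=> s0 h; apply/eqP; rewrite eq_le hausdorff_measure_ge0 andbT.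
apply: ge_ereal_sup => _ [d /= d0 <-]; apply/lee_addgt0Pr => e e0; rewrite add0e.
have e0' : (0 < Num.min e (d `^ s))%R by rewrite lt_min e0 powR_gt0.
have [|_ [U [_ AU] <-]] := @lb_ereal_inf_adherent _
   [set \sum_(k <oo) (hausdorff_gauge s) (U k) | U in
     @measurable_cover _ (g_sigma_algebraType [set: set R]) A] _ e0'.
  by rewrite -/(mu_ext _ _) -/(hausdorff_content s A) h.
rewrite -/(mu_ext _ _) -/(hausdorff_content s A) h add0e => hlt.
apply: (@le_trans _ _ (\sum_(k <oo) hausdorff_gauge s (U k))); last first.
  by rewrite (le_trans (ltW hlt)) // lee_fin ge_min lexx.
apply: ereal_inf_lbound; exists U => //; split=> // k.
have [->|U0] := eqVneq (U k) set0.
  apply: diameter_le; first exact: ltW.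
  by [].
rewrite leNgt; apply/negP => dU.
have : hausdorff_gauge s (U k) < (d `^ s)%:E.
  apply: (@le_lt_trans _ _ (\sum_(k <oo) hausdorff_gauge s (U k))).
    rewrite (nneseriesD1 (n := k)) //; last by move=> *; exact: hausdorff_gauge_ge0.
    by rewrite leeDl // nneseries_ge0 // => *; exact: hausdorff_gauge_ge0.
  by apply: (lt_le_trans hlt); rewrite lee_fin ge_min lexx orbT.
rewrite /hausdorff_gauge (negbTE U0) ltNge -poweR_EFin => /negP; apply.
apply: gt0_ler_poweR; rewrite ?in_itv /= ?leey ?lee_fin ?diameter_ge0 ?(ltW d0) //.
- exact: ltW.
- exact: ltW.
Qed.

Lemma le_hausdorff_measure s A B : A `<=` B ->
  hausdorff_measure s A <= hausdorff_measure s B.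
Proof.
move=> AB; apply: ge_ereal_sup => _ [d d0 <-].
apply: ereal_sup_ge; exists (hausdorff_premeasure s d B); first by exists d.
apply: le_ereal_inf_tmp => _ [U [BU Ud] <-]; apply: ereal_inf_lbound.
by exists U => //; split=> //; exact: subset_trans BU.
Qed.

(** The gap between [s] and [s'] leaves room for the digits lost in the coding and disappears in the
    infimum. *)
Lemma hausdorff_dim_le A B :
  (forall s s', (0 <= s < s')%R -> hausdorff_measure s B = 0 ->
    hausdorff_measure s' A = 0) ->
  hausdorff_dim A <= hausdorff_dim B.
Proof.
move=> h; apply: le_ereal_inf_tmp => _ [s [s0 Bs] <-].
apply/lee_addgt0Pr => e e0; apply: ereal_inf_lbound.
exists (s + e)%R => //; split; first lra.
by apply: h Bs; lra.
Qed.

Lemma hausdorff_dim_mono A B : A `<=` B -> hausdorff_dim A <= hausdorff_dim B.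
Proof.
move=> AB; apply: le_ereal_inf_tmp => _ [s [s0 Bs] <-]; apply: ereal_inf_lbound.
exists s => //; split=> //; apply/eqP; rewrite eq_le hausdorff_measure_ge0 andbT.
by rewrite -Bs le_hausdorff_measure.
Qed.

(** Replaces a Hölder condition on an inverse of [f], which may fail to be injective: fine covers of
    [B] are pulled back, and only the content of each preimage is controlled. *)
Lemma hausdorff_content_transfer s s' d C A B (f : R -> R) :
  (0 < d)%R -> (0 <= C)%R -> f @` A `<=` B -> hausdorff_measure s B = 0 ->
  (forall U, diameter U <= d%:E ->
    hausdorff_content s' (A `&` f @^-1` U) <= C%:E * hausdorff_gauge s U) ->
  hausdorff_content s' A = 0.
Proof.
move=> d0 C0 fAB Bs h; apply/eqP; rewrite eq_le outer_measure_ge0 andbT.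
apply/lee_addgt0Pr => e e0; rewrite add0e.
have C1 : (0 < C + 1)%R by lra.
have [|U [BU Ud] Ue] := delta_cover_null (e := (e / (C + 1))%R) Bs d0.
  by rewrite divr_gt0.
apply: (@le_trans _ _ (hausdorff_content s' (\bigcup_k (A `&` f @^-1` U k)))).
  apply: le_outer_measure => x Ax.
  have [|k _ Uk] := BU (f x); first by apply: fAB; exists x.
  by exists k.
apply: (le_trans (outer_measure_sigma_subadditive _ _)).
apply: (@le_trans _ _ (\sum_(0 <= k <oo) (C%:E * hausdorff_gauge s (U k)))).
  by apply: lee_nneseries => k *; [exact: outer_measure_ge0 | exact: h].
rewrite nneseriesZl; last by move=> *; exact: hausdorff_gauge_ge0.
apply: (@le_trans _ _ (C%:E * (e / (C + 1))%:E)); first by rewrite lee_wpmul2l.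
rewrite -EFinM lee_fin mulrA ler_pdivrMr // mulrC ler_wpM2l ?(ltW e0) //; lra.
Qed.

End HausdorffContent.

(** * Expansions in a multinacci base *)

Lemma expr_small (R : realType) (z e : R) : 0 <= z < 1 -> 0 < e ->
  exists N, forall n, (N <= n)%N -> z ^+ n < e.
Proof.
move=> /andP[z0 z1] e0.
have /cvgrPdist_lt/(_ e e0)[N _ hN] : z ^+ n @[n --> \oo] --> (0 : R).
  by apply: cvg_expr; rewrite ger0_norm.
exists N => n /hN /=; rewrite sub0r normrN ger0_norm // exprn_ge0 //.
Qed.

Section BetaExpansion.
Variables (R : realType) (beta : R).
Hypotheses (b1 : 1 < beta) (b2 : beta < 2).
Implicit Types (x y : R) (a : nat -> bool).
Notation T := (beta_map beta).
Notation g := (beta^-1).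

Let b0 : 0 < beta. Proof. by apply: lt_trans b1. Qed.
Let g0 : 0 < g. Proof. by rewrite invr_gt0. Qed.
Let g1 : g < 1. Proof. by rewrite invf_lt1. Qed.
Let bg : beta * g = 1. Proof. by rewrite divff // gt_eqF. Qed.

(** For [x] in [[0, 1)] this is the integer part of [beta * iter k T x], which is 0 or 1 since
    [beta < 2]. *)
Definition digit x k : bool := 1 <= beta * iter k T x.

Lemma beta_map_digit x : 0 <= x < 1 -> T x = beta * x - (digit x 0)%:R.
Proof.
move=> /andP[x0 x1]; rewrite /beta_map /digit /=.
have bx0 : 0 <= beta * x by rewrite mulr_ge0 // ltW.
have bx2 : beta * x < 2 by apply: (lt_trans _ b2); rewrite gtr_pMr.
case: (leP 1 (beta * x)) => h.
  by rewrite (@floor_def _ _ 1) // intrD !mulr1z h /=; lra.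
by rewrite (@floor_def _ _ 0) // add0r mulr1z mulr0z bx0.
Qed.

Lemma iter_beta_map_itv x n : 0 <= x < 1 -> 0 <= iter n T x < 1.
Proof.
move=> hx; elim: n => //= n IH; rewrite beta_map_digit // /digit /=.
move: (iter n T x) IH => y /andP[y0 y1].
have by0 : 0 <= beta * y by rewrite mulr_ge0 // ltW.
have by2 : beta * y < 2 by apply: (lt_trans _ b2); rewrite gtr_pMr.
by case: (leP 1 (beta * y)) => h; rewrite /= ?mulr1n ?mulr0n; lra.
Qed.

Lemma digit_shift x n : digit (iter n T x) = shift n (digit x).
Proof. by apply/funext => k; rewrite /digit /shift -iterD addnC. Qed.

Lemma iter_sub x y n : 0 <= x < 1 -> 0 <= y < 1 ->
  (forall k, (k < n)%N -> digit x k = digit y k) ->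
  iter n T x - iter n T y = beta ^+ n * (x - y).
Proof.
move=> hx hy; elim: n => [_|n IH h]; first by rewrite expr0 mul1r.
rewrite !iterS !beta_map_digit ?iter_beta_map_itv // exprS -mulrA -IH.
  by move: (h n (ltnSn n)); rewrite /digit /= => ->; ring.
by move=> k kn; apply: h; lia.
Qed.

Lemma lexle_digit x y : 0 <= x -> x <= y -> y < 1 -> lexle (digit x) (digit y).
Proof.
move=> x0 xy y1 n h; rewrite {1 2}/digit => hx.
have := @iter_sub x y n; rewrite x0 (le_lt_trans xy y1) (le_trans x0 xy) y1.
move=> /(_ erefl erefl h) hs.
rewrite /digit (le_trans hx) // ler_pM2l // -subr_le0 hs.
by rewrite pmulr_rle0 ?exprn_gt0 // subr_le0.
Qed.

Lemma cylinder_dist u x y : 0 <= x < 1 -> 0 <= y < 1 ->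
  starts_with u (digit x) -> starts_with u (digit y) -> `|x - y| <= g ^+ size u.
Proof.
move=> hx hy ux uy.
have E := @iter_sub x y (size u) hx hy (fun k hk => etrans (ux k hk) (esym (uy k hk))).
have hn : 0 < beta ^+ size u by rewrite exprn_gt0.
rewrite exprVn -div1r ler_pdivlMr // mulrC -[X in X * _]gtr0_norm // -normrM -E.
have /andP[? ?] := iter_beta_map_itv (size u) hx.
have /andP[? ?] := iter_beta_map_itv (size u) hy.
by rewrite ler_norml; lra.
Qed.

Definition value a : R := limn (series (fun k => (a k)%:R * g ^+ k.+1)).

Let geo_cvg : cvgn (series (fun k => g ^+ k.+1)).
Proof.
have := @is_cvg_geometric_series R g g; rewrite ger0_norm ?ltW // => /(_ g1).
by congr (cvgn _); congr series; apply/funext => k; rewrite /= exprS.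
Qed.

Lemma is_cvg_value a : cvgn (series (fun k => (a k)%:R * g ^+ k.+1)).
Proof.
apply: (series_le_cvg _ _ _ geo_cvg) => k.
- by rewrite mulr_ge0 // exprn_ge0 // ltW.
- by rewrite exprn_ge0 // ltW.
- by case: (a k); rewrite ?mul1r ?mul0r ?exprn_ge0 // ltW.
Qed.

Lemma value_rec a : value a = ((a 0%N)%:R + value (shift 1 a)) * g.
Proof.
have h := @is_cvg_value a; move: (h).
rewrite -(cvg_shiftS (series _)) => h'.
apply: (cvg_unique (@Rhausdorff R) h'). 
have -> : (fun n => series (fun k => (a k)%:R * g ^+ k.+1) n.+1) =
   (fun n => ((a 0%N)%:R + series (fun k => (shift 1 a k)%:R * g ^+ k.+1) n) * g).
  apply/funext => n; rewrite /series /= big_nat_recl // mulrDl expr1; congr (_ + _).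
  rewrite mulr_suml; apply: eq_bigr => k _.
  by rewrite /shift add1n [g ^+ k.+2]exprSr mulrA.
apply: cvgM; last exact: cvg_cst.
by apply: cvgD; [exact: cvg_cst | exact: is_cvg_value].
Qed.

Lemma value_ge0 a : 0 <= value a.
Proof.
apply: limr_ge; first exact: is_cvg_value.
near=> n; apply: sumr_ge0 => k _; rewrite mulr_ge0 // exprn_ge0 // ltW //.
Unshelve. all: by end_near. Qed.

Definition value_bound : R := limn (series (fun k => g ^+ k.+1)).

Lemma value_le_bound a : value a <= value_bound.
Proof.
apply: ler_lim; [exact: is_cvg_value | exact: geo_cvg |].
near=> n; apply: ler_sum => k _.
by case: (a k); rewrite ?mul1r ?mul0r ?exprn_ge0 // ltW.
Unshelve. all: by end_near. Qed.

Lemma shiftD i j a : shift i (shift j a) = shift (j + i) a.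
Proof. by apply/funext => k; rewrite /shift addnA. Qed.

Lemma value_sub a s n : (forall k, (k < n)%N -> a k = s k) ->
  value a - value s = g ^+ n * (value (shift n a) - value (shift n s)).
Proof.
elim: n => [_|n IH h]; first by rewrite mul1r.
rewrite IH; last by move=> k hk; apply: h; lia.
rewrite (value_rec (shift n a)) (value_rec (shift n s)) !shiftD !addn1 /shift addn0.
rewrite h // exprSr; ring.
Qed.

(** Concludes recursions in which an error shrinks by a factor [g] at each step. *)
Lemma le0_of_geometric_bound (e C : R) : (forall n, e <= C * g ^+ n) -> e <= 0.
Proof.
move=> h; rewrite leNgt; apply/negP => e0.
have C0 : 0 < C by have := h 0%N; rewrite expr0 mulr1; apply: lt_le_trans.
have [|N hN] := @expr_small R g (e / C) _ (divr_gt0 e0 C0).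
  by rewrite g1 ltW.
by have := h N; rewrite leNgt mulrC -ltr_pdivlMr // hN.
Qed.

Lemma value_digit x : 0 <= x < 1 -> value (digit x) = x.
Proof.
move=> hx.
have E n : value (digit x) - x = g ^+ n * (value (shift n (digit x)) - iter n T x).
  elim: n => [|n ->]; first by rewrite mul1r.
  rewrite value_rec shiftD addn1 {1}/shift addn0 iterS.
  rewrite beta_map_digit ?iter_beta_map_itv // (_ : digit (iter n T x) 0 = digit x n) //.
  by rewrite -{1}[iter n T x]mul1r -bg exprSr; ring.
have B n : `|value (digit x) - x| <= (value_bound + 1) * g ^+ n.
  have gn : 0 <= g ^+ n by rewrite exprn_ge0 // ltW.
  rewrite (E n) normrM ger0_norm // mulrC ler_wpM2r //.
  have /andP[? ?] := iter_beta_map_itv n hx.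
  have := value_le_bound (shift n (digit x)); have := value_ge0 (shift n (digit x)).
  by move=> ? ?; rewrite ler_norml; lra.
by apply/eqP; rewrite -subr_eq0 -normr_le0; apply: le0_of_geometric_bound B.
Qed.

Definition ones n : R := \sum_(k < n) g ^+ k.+1.

Lemma onesS n : ones n.+1 = ones n + g ^+ n.+1.
Proof. by rewrite /ones big_ord_recr. Qed.

Lemma le_ones n k : (n <= k)%N -> ones n <= ones k.
Proof.
move=> /subnKC <-; elim: (k - n)%N => [|i IH]; first by rewrite addn0.
by rewrite addnS onesS (le_trans IH) // lerDl exprn_ge0 // ltW.
Qed.

Lemma value_ones n a : (forall k, (k < n)%N -> a k) ->
  value a = ones n + value (shift n a) * g ^+ n.
Proof.
elim: n => [|n IH] h.
  by rewrite /ones big_ord0 add0r mulr1.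
rewrite IH; last by move=> k hk; apply: h; lia.
rewrite value_rec shiftD addn1 {1}/shift addn0 h // onesS exprS /=; ring.
Qed.

Lemma value_ones_zero n a : (forall k, (k < n)%N -> a k) -> a n = false ->
  value a = ones n + value (shift n.+1 a) * g ^+ n.+1.
Proof.
move=> h an; rewrite (value_ones h) value_rec shiftD addn1 {1}/shift addn0 an exprS.
by rewrite add0r; ring.
Qed.

(** * Admissible sequences of a multinacci base *)

Section Multinacci.
Variable m : nat.
Hypothesis bm : beta ^+ m.+1 = \sum_(i < m.+1) beta ^+ i.

Lemma ones_max : ones m.+1 = 1.
Proof.
rewrite /ones (reindex_inj rev_ord_inj) /=.
rewrite (eq_bigr (fun k : 'I_m.+1 => g ^+ m.+1 * beta ^+ k)).
  by rewrite -mulr_sumr -bm -exprMn mulrC bg expr1n.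
case=> k km _ /=; rewrite (_ : g ^+ m.+1 = g ^+ ((m.+1 - k.+1).+1 + k)); last first.
  by congr (_ ^+ _); lia.
by rewrite exprD -mulrA -exprMn [g * _]mulrC bg expr1n mulr1.
Qed.

Lemma ones_lt1 n : (n <= m)%N -> ones n < 1.
Proof.
move=> nm; rewrite -ones_max onesS (le_lt_trans (le_ones nm)) // ltrDl exprn_gt0 //.
Qed.

(** Splitting off the first block of [i <= m] ones and a zero,
    [ones i + g ^+ i.+1 = ones i.+1 <= 1]; hence the excess over 1 shrinks by a factor [g] or better
    per block. *)
Lemma value_le1 a : no_run m a -> value a <= 1.
Proof.
have v0 : 0 <= value_bound by exact: le_trans (value_ge0 a) (value_le_bound a).
move=> ha; rewrite -subr_le0; apply: (@le0_of_geometric_bound _ value_bound) => n.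
rewrite lerBlDl; elim: n a ha => [|n IH] a ha.
  by rewrite mulr1 (le_trans (value_le_bound a)) // lerDr.
have [i [im ai a0]] := no_run_first_zero ha.
rewrite (value_ones_zero ai a0).
have := IH _ (no_run_shift i.+1 ha).
have gi : 0 < g ^+ i by rewrite exprn_gt0.
have gi1 : g ^+ i <= 1 by rewrite exprn_ile1 // ltW.
have gn : 0 <= g ^+ n by rewrite exprn_ge0 // ltW.
have oi : ones i + g ^+ i.+1 <= 1 by rewrite -onesS -ones_max le_ones.
move=> h; apply: (@le_trans _ _ (ones i + (1 + value_bound * g ^+ n) * g ^+ i.+1)).
  by rewrite lerD2l ler_wpM2r // exprn_ge0 // ltW.
rewrite mulrDl mul1r addrA lerD // exprS -mulrA ler_wpM2l //.
rewrite exprS mulrCA ler_pM2l // ler_piMr //.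
Qed.

Lemma value_eq1 a : no_run m a -> value a = 1 ->
  [/\ forall k, (k < m)%N -> a k, a m = false & value (shift m.+1 a) = 1].
Proof.
move=> ha va; have [i [im ai a0]] := no_run_first_zero ha.
have := value_ones_zero ai a0; rewrite va => E.
have v1 := value_le1 (no_run_shift i.+1 ha).
have gi : 0 < g ^+ i.+1 by rewrite exprn_gt0.
have {}im : i = m.
  apply/eqP; rewrite eqn_leq im /= leqNgt; apply/negP => hi.
  have := ones_lt1 hi; rewrite onesS; nra.
subst i; split=> //.
have := ones_max; rewrite onesS; nra.
Qed.

(** By [value_eq1], value 1 forces every block to be [m] ones and a zero, which puts the zeros at
    distance [m.+1]. The induction moves a close pair towards the front, block by block. *)
Lemma value_lt1 a : no_run m a -> close_zeros m a -> value a < 1.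
Proof.
move=> ha /(_ 0%N)[k [d [_ hd ak ad]]].
rewrite lt_neqAle value_le1 // andbT; apply/eqP => va.
elim/ltn_ind: k a ha va ak ad => k IH a ha va ak ad.
have [a1 am vs] := value_eq1 ha va.
have [km|km|km] := ltngtP k m.
- by have := a1 k km; rewrite ak.
- apply: (IH (k - m.+1)%N _ (shift m.+1 a)) => //; first lia.
  + exact: no_run_shift.
  + by rewrite /shift subnKC.
  + by rewrite /shift addnA subnKC.
- have [s1 _ _] := value_eq1 (no_run_shift m.+1 ha) vs.
  have := s1 d.-1; rewrite /shift (_ : (m.+1 + d.-1 = k + d)%N) ?ad; last lia.
  by move=> h; suff: false by []; apply: h; lia.
Qed.

(** All tails have value below 1, so the floor in [beta_map] removes exactly the leading digit. *)
Lemma iter_value a n : no_run m a -> close_zeros m a ->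
  iter n T (value a) = value (shift n a).
Proof.
move=> ha ca; elim: n => [//|n IH].
rewrite iterS IH; have v : 0 <= value (shift n.+1 a) < 1.
  by rewrite value_ge0 value_lt1 //; [exact: no_run_shift | exact: close_zeros_shift].
have E : beta * value (shift n a) = (a n)%:R + value (shift n.+1 a).
  by rewrite value_rec shiftD addn1 {1}/shift addn0 mulrCA bg mulr1.
rewrite /beta_map E (@floor_def _ _ (a n : nat)) ?addrK //.
  by rewrite addrC addKr.
by rewrite -!pmulrn; case: (a n); rewrite /=; lra.
Qed.

Lemma digit_no_run x : 0 <= x < 1 -> no_run m (digit x).
Proof.
move=> hx n; apply/not_exists2P => h.
have /andP[_] := iter_beta_map_itv n hx.
rewrite ltNge -(value_digit (iter_beta_map_itv n hx)) digit_shift.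
rewrite (@value_ones m.+1) ?ones_max ?lerDl; first by rewrite mulr_ge0 ?value_ge0 ?exprn_ge0 ?ltW.
move=> k hk; rewrite /shift; have [|] := h (n + k)%N; first lia.
by case: digit.
Qed.

(** Otherwise the digits after some zero are [m] ones and a zero repeated forever, a tail of value
    1, whereas an orbit point is below 1. The bound [1 - value <= g ^+ k] is proved for all late
    zeros at once. *)
Lemma digit_close_zeros x : 0 <= x < 1 -> close_zeros m (digit x).
Proof.
move=> hx n; apply: contrapT => no.
have nr := digit_no_run hx.
have [z hz dz] := nr n.
have /andP[_] := iter_beta_map_itv z.+1 hx.
rewrite ltNge => /negP; apply; rewrite -(value_digit (iter_beta_map_itv z.+1 hx)) digit_shift.
rewrite -subr_le0; apply: (@le0_of_geometric_bound _ 1) => k; rewrite mul1r.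
have {hz} : (n <= z)%N by lia.
elim: k z dz => [|k IH] z dz hz; first by rewrite expr0 lerBlDl lerDr value_ge0.
have ones_z j : (j < m)%N -> shift z.+1 (digit x) j.
  move=> hj; apply/negPn/negP => /negbTE h; apply: no.
  exists z, j.+1; split=> //.
  by move: h; rewrite /shift addSnnS.
(* After [m] ones the absence of longer runs forces a zero. *)
have zero_z : shift z.+1 (digit x) m = false.
  have [k' hk dk] := nr z.+1.
  have [hm|hm] := ltnP (k' - z.+1) m.
    have zk : (z < k')%N by case/andP: hk.
    by have := ones_z _ hm; rewrite /shift subnKC // dk.
  have e : (z.+1 + m = k')%N by move: hk hm => /andP[]; lia.
  by rewrite /shift e.
have := IH _ zero_z; rewrite -addnS => /(_ ltac:(lia)).
rewrite (value_ones_zero ones_z zero_z) shiftD -{2}ones_max onesS.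
have : g ^+ m <= 1 by rewrite exprn_ile1 // ltW.
have : 0 <= g ^+ m by rewrite exprn_ge0 // ltW.
have : 0 <= g ^+ k by rewrite exprn_ge0 // ltW.
rewrite ![g ^+ _.+1]exprS => k0 m0 m1 h.
have -> : ones m + g * g ^+ m - (ones m + value (shift (z.+1 + m.+1) (digit x)) * (g * g ^+ m))
  = g * ((1 - value (shift (z.+1 + m.+1) (digit x))) * g ^+ m) by ring.
rewrite ler_pM2l //; apply: (@le_trans _ _ (g ^+ k * g ^+ m)).
  by rewrite ler_wpM2r.
by rewrite ler_piMr.
Qed.

(** At the first difference, a 0 followed by a tail of value at most 1 meets a 1 followed by a tail
    of value at least 0. *)
Lemma lexle_value a s : no_run m a -> no_run m s -> lexle a s -> value a <= value s.
Proof.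
move=> ha hs h; have [E|] := pselect (forall k, a k = s k).
  by rewrite (_ : a = s) //; apply/funext.
move/existsNP => [k0 /eqP hk0].
have ex : exists k, a k != s k by exists k0.
case: (ex_minnP ex) => n an hn.
have E k : (k < n)%N -> a k = s k.
  by move=> kn; apply/eqP/negPn/negP => /hn; lia.
rewrite -subr_le0 (value_sub E) pmulr_rle0 ?exprn_gt0 //.
have := h n E; move: an; case an: (a n); case sn: (s n) => // _; first by move/(_ erefl).
move=> _.
rewrite (value_rec (shift n a)) (value_rec (shift n s)) !shiftD {1 3}/shift addn0 an sn /=.
have := value_le1 (no_run_shift (n + 1) ha).
by have := value_ge0 (shift (n + 1) s); rewrite -mulrBl pmulr_lle0 //; lra.
Qed.

(** At a first difference [k < n], the tail after the 1 is worth at least [c] and the one after the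
    0 at most 1, so the values differ by at least [c * g ^+ k.+1]. *)
Lemma value_separation a s c n : no_run m a -> no_run m s ->
  (forall k, c <= value (shift k a)) -> (forall k, c <= value (shift k s)) ->
  `|value a - value s| < c * g ^+ n ->
  forall k, (k < n)%N -> a k = s k.
Proof.
move=> ha hs ca cs h; elim/ltn_ind => k IH kn.
have E j : (j < k)%N -> a j = s j by move=> hj; apply: IH => //; lia.
apply/eqP/negPn/negP => ne; move: h; apply/negP; rewrite -leNgt (value_sub E).
have gk : 0 < g ^+ k by rewrite exprn_gt0.
rewrite normrM (gtr0_norm gk) (value_rec (shift k a)) (value_rec (shift k s)).
rewrite !shiftD addn1 /shift addn0 -/(shift _ _) -/(shift _ _) -mulrBl normrM (gtr0_norm g0).
have c0 : 0 <= c \/ c < 0 by case: (leP 0 c); [left | right].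
have gn : 0 <= g ^+ n by rewrite exprn_ge0 // ltW.
case: c0 => c0; last first.
  apply: (@le_trans _ _ 0); first by rewrite nmulr_rle0.
  by rewrite !mulr_ge0 // ltW.
rewrite mulrCA -exprSr; apply: ler_pM => //; last by rewrite ler_wiXn2l // ltW.
have := value_le1 (no_run_shift k.+1 ha); have := value_le1 (no_run_shift k.+1 hs).
have := ca k.+1; have := cs k.+1; move: ne.
case: (a k); case: (s k) => //= _ ? ? ? ?; rewrite ler_normr; apply/orP; [left|right]; lra.
Qed.

End Multinacci.
End BetaExpansion.

(** * Coding survivors by points of the bifurcation set *)

Section Survivors.
Variables (R : realType) (beta : R).
Hypotheses (b1 : 1 < beta) (b2 : beta < 2).
Notation T := (beta_map beta).
Notation K := (survivor_set beta).

(** The floor is right-continuous, so each iterate is affine just to the right of any point, even at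
    a discontinuity. *)
Lemma iter_beta_map_right x n : exists2 d, 0 < d &
  forall y, x <= y < x + d -> iter n T y = iter n T x + beta ^+ n * (y - x).
Proof.
have b0 : 0 < beta by apply: lt_trans b1.
elim: n => [|n [d d0 IH]].
  by exists 1 => // y _; rewrite /= mul1r addrC subrK.
set z := iter n T x in IH *.
have /andP[fz1 fz2] := floor_itv (beta * z).
set e := (Num.floor (beta * z) + 1)%:~R - beta * z.
have e0 : 0 < e by rewrite subr_gt0.
have bn : 0 < beta ^+ n.+1 by rewrite exprn_gt0.
exists (Num.min d (e / beta ^+ n.+1)); first by rewrite lt_min d0 divr_gt0.
move=> y /andP[xy]; rewrite -ltrBlDl lt_min ltrBlDl ltr_pdivlMr // => /andP[yd ye].
rewrite !iterS IH ?xy // -/z /beta_map.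
have E : beta * (z + beta ^+ n * (y - x)) = beta * z + (y - x) * beta ^+ n.+1.
  by rewrite exprS; ring.
have yx : 0 <= (y - x) * beta ^+ n.+1 by rewrite mulr_ge0 ?subr_ge0 // ltW.
rewrite E (@floor_def _ _ (Num.floor (beta * z))); first by ring.
apply/andP; split; first by rewrite (le_trans fz1) // lerDl.
by rewrite -ltrBrDl.
Qed.

Lemma survivor_iter t x k : K t x -> K t (iter k T x).
Proof.
move=> [hx h]; split; first exact: iter_beta_map_itv.
by move=> n; rewrite -iterD.
Qed.

(** If [iter n T s < s], every point slightly to the right of [s] also falls below [s] after [n]
    steps; no orbit in [K s] comes there, so raising the level a little leaves [K s] unchanged. *)
Lemma bifurcation_setE : bifurcation_set beta = [set s | K s s].
Proof.
apply/seteqP; split=> s /=; last first.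
  move=> [hs h]; split=> // t' /andP[st' _] E.
  have : K t' s by rewrite E.
  by move=> [_ /(_ 0%N)]; rewrite /= leNgt st'.
move=> [hs h]; split=> // n; rewrite leNgt; apply/negP => ns.
have [d d0 hd] := iter_beta_map_right s n.
have bn : 0 < beta ^+ n by rewrite exprn_gt0 // (lt_trans _ b1).
pose e := Num.min d (Num.min (1 - s) ((s - iter n T s) / beta ^+ n)).
have e0 : 0 < e by rewrite !lt_min d0 divr_gt0 ?subr_gt0 // andbT; lra.
have [ed es en] : [/\ e <= d, e <= 1 - s & e * beta ^+ n <= s - iter n T s].
  rewrite -ler_pdivlMr //; split; rewrite /e !ge_min lexx ?orbT //.
have [|] := h (s + e / 2); first lra.
apply/seteqP; split=> x [hx hK]; split=> // k; first by apply: le_trans (hK k); lra.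
rewrite leNgt; apply/negP => lt.
have := hK (n + k)%N; rewrite iterD hd; last by have := hK k; lra.
have : beta ^+ n * (iter k T x - s) < e * beta ^+ n.
  by rewrite mulrC ltr_pM2r //; lra.
lra.
Qed.

(** If the orbit of the infimum dropped below [t], so would the orbits of all nearby points to its
    right, among them survivors. *)
Lemma survivor_min t : K t !=set0 -> exists2 p, K t p & forall x, K t x -> p <= x.
Proof.
move=> K0; have hi : has_inf (K t) by split=> //; exists 0 => x [/andP[]].
have lb x : K t x -> inf (K t) <= x by move=> Kx; apply: ge_inf => //; case: hi.
exists (inf (K t)) => //.
have p1 : inf (K t) < 1.
  by have [x Kx] := K0; apply: le_lt_trans (lb x Kx) _; case: Kx => /andP[].
split; first by rewrite p1 andbT; apply: lb_le_inf => // x [/andP[]].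
move=> n; rewrite leNgt; apply/negP => nt.
have [d d0 hd] := iter_beta_map_right (inf (K t)) n.
have bn : 0 < beta ^+ n by rewrite exprn_gt0 // (lt_trans _ b1).
set e := Num.min d ((t - iter n T (inf (K t))) / beta ^+ n).
have e0 : 0 < e by rewrite lt_min d0 divr_gt0 // subr_gt0.
have [x Kx xe] := inf_adherent e0 hi.
move: xe; rewrite -ltrBlDl lt_min ltrBlDl ltr_pdivlMr // => /andP[xd xt].
have := Kx.2 n; rewrite hd ?lb //; lra.
Qed.

End Survivors.

Lemma powR_expr (R : realType) (x s : R) n : 0 <= x -> (x ^+ n) `^ s = (x `^ s) ^+ n.
Proof. move=> x0; rewrite -powR_mulrn // -powRrM [X in _ `^ X]mulrC powRrM powR_mulrn //.
exact: powR_ge0. Qed.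

Lemma powR_lt1 (R : realType) (x s s' : R) : 0 < x < 1 -> s < s' -> x `^ s' < x `^ s.
Proof.
move=> /andP[x0 x1] ss; rewrite /powR gt_eqF // ltr_expR ltr_nM2r //.
by rewrite ln_lt0 // x0.
Qed.

(** * Content estimates for the coding map *)

Section Estimate.
Variables (R : realType) (beta : R).
Hypotheses (b1 : 1 < beta) (b2 : beta < 2).
Variable m : nat.
Hypothesis bm : beta ^+ m.+1 = \sum_(i < m.+1) beta ^+ i.
Notation T := (beta_map beta).
Notation K := (survivor_set beta).
Notation g := (beta^-1).
Notation digit := (digit beta).
Notation value := (value beta).

Let g0 : 0 < g. Proof. by rewrite invr_gt0 (lt_trans _ b1). Qed.
Let g1 : g < 1. Proof. by rewrite invf_lt1 // (lt_trans _ b1). Qed.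

Lemma survivor_lexle t p x : (forall y, K t y -> p <= y) -> K t p -> K t x ->
  forall k, lexle (digit p) (shift k (digit x)).
Proof.
move=> pmin Kp Kx k; rewrite -digit_shift.
have Kk := survivor_iter b1 b2 k Kx.
by case: Kp (pmin _ Kk) (Kk) => /andP[? ?] _ ? [/andP[? ?] _]; exact: lexle_digit.
Qed.

Lemma value_ge_digit (a : nat -> bool) r : a r -> g ^+ r.+1 <= value a.
Proof.
elim: r a => [|r IH] a ar; rewrite (value_rec b1).
  by rewrite ar expr1 ler_peMl ?(ltW g0) // lerDl value_ge0.
rewrite exprSr ler_pM2r //; apply: (le_trans (IH (shift 1 a) ar)).
by rewrite lerDr.
Qed.

(** The condition on [x] stands under the existential so that [choice] yields a total function. *)
Lemma digit_first_zero x : exists j, 0 <= x < 1 ->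
  [/\ (j <= m)%N, forall k, (k < j)%N -> digit x k & digit x j = false].
Proof.
have [hx|nx] := pselect (0 <= x < 1); last by exists 0%N.
by have [j hj] := no_run_first_zero (digit_no_run b1 b2 bm hx); exists j.
Qed.

Section Code.
Variables (t p : R) (q r : nat) (f : R -> nat).
Hypotheses (Kp : K t p) (pmin : forall y, K t y -> p <= y).
Notation b := (digit p).
Hypotheses (q0 : (0 < q)%N) (qr : (q < r)%N) (bq : b q = false) (br : b r = false).
Hypothesis zq : exists2 z, (q - m <= z < q)%N & b z = false.
Hypothesis zr : exists2 z, (r - m <= z < r)%N & b z = false.
Hypothesis cq : exists k d, [/\ (0 < d <= m)%N, (k + d < q)%N, b k = false & b (k + d) = false].
Hypothesis hf : forall x, 0 <= x < 1 ->
  [/\ (f x <= m)%N, forall k, (k < f x)%N -> digit x k & digit x (f x) = false].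

(** The leading ones of [x] are dropped so that a 0 follows the 1 at position [r]; at most [m]
    digits are lost, which costs a factor [m.+1] in counting. *)
Definition code x := splice r b (recode q b (shift (f x) (digit x))).

Let hb : forall k, lexle b (shift k b). Proof. exact: survivor_lexle Kp. Qed.
Let hx x : K t x -> forall k, lexle b (shift k (shift (f x) (digit x))).
Proof. by move=> Kx k; rewrite shiftD; exact: survivor_lexle Kx _. Qed.

Lemma code_no_run x : K t x -> no_run m (code x).
Proof.
move=> [x01 _]; apply: no_run_splice => //.
- by case: Kp => ? _; exact: digit_no_run.
- by apply: recode_no_run => //; exact/no_run_shift/digit_no_run.
- by rewrite recode0 // /shift addn0; have [] := hf x01.
Qed.

Lemma code_close_zeros x : K t x -> close_zeros m (code x).
Proof.
move=> [x01 _]; apply: close_zeros_splice; apply: recode_close_zeros => //.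
exact/close_zeros_shift/digit_close_zeros.
Qed.

Lemma code_lexle x : K t x -> forall n, lexle (code x) (shift n (code x)).
Proof. by move=> Kx n; apply: splice_recode_lexle => //; exact: hx. Qed.

Lemma value_code_le x n : K t x -> value (code x) <= value (shift n (code x)).
Proof.
move=> Kx; apply: (lexle_value b1 b2 bm); [exact: code_no_run| |exact: code_lexle].
exact/no_run_shift/code_no_run.
Qed.

Lemma value_code x : K t x ->
  (bifurcation_set beta `&` [set` `[t, 1]]) (value (code x)).
Proof.
move=> Kx; have nr := code_no_run Kx; have cz := code_close_zeros Kx.
have v1 : value (code x) < 1 by exact: (value_lt1 b1 b2 bm).
have v0 : 0 <= value (code x) by exact: (value_ge0 b1).
rewrite bifurcation_setE //; split => /=.
  split; first by rewrite v0.
  by move=> n; rewrite (iter_value b1 b2 bm) //; exact: value_code_le.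
rewrite in_itv /= (ltW v1) andbT.
have p01 : 0 <= p < 1 by case: Kp.
have tp : t <= p by case: Kp => _ /(_ 0%N).
apply: (le_trans tp); rewrite -[p](value_digit b1 b2 p01).
apply: (lexle_value b1 b2 bm) => //; first exact: digit_no_run.
by have [] := @lexle_splice _ _ (recode q b (shift (f x) (digit x))) r 0%N (@hb 0%N) br (leq0n _).
Qed.

(** Each tail of a code is worth at least the code itself, hence at least [g ^+ r.+1] by its 1 at
    position [r]; this is the [c] of [value_separation]. *)
Lemma code_separation x y n : K t x -> K t y ->
  `|value (code x) - value (code y)| < g ^+ r.+1 * g ^+ (n + r.+1) ->
  forall k, (k < n)%N ->
    recode q b (shift (f x) (digit x)) k = recode q b (shift (f y) (digit y)) k.
Proof.
move=> Kx Ky h k kn.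
have lb w : K t w -> forall i, g ^+ r.+1 <= value (shift i (code w)).
  move=> Kw i; apply: le_trans (value_code_le i Kw).
  by apply: value_ge_digit; rewrite /code splice_at.
have := value_separation b1 b2 bm (code_no_run Kx) (code_no_run Ky) (lb x Kx) (lb y Ky) h.
move=> /(_ (r.+1 + k)%N); rewrite /code !splice_gt; apply; lia.
Qed.

Variables (s' rho : R).
Hypotheses (s'0 : 0 < s') (rho0 : 0 <= rho) (zrho : g `^ s' <= rho).
Hypothesis hq : g `^ s' * rho ^+ q + (g `^ s') ^+ q <= rho ^+ q.+1.

(** Codes this close share [n] recoded digits, so the points lie in the cylinders of the words [u]
    of [recode_preimages], each preceded by up to [m] dropped ones. *)
Lemma code_cylinder_content x0 n : K t x0 ->
  (hausdorff_content s' [set x | K t x /\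
     (`|value (code x) - value (code x0)| < g ^+ r.+1 * g ^+ (n + r.+1))%R]
   <= (m.+1%:R * rho ^+ n)%:E)%E.
Proof.
move=> Kx0; have z0 : 0 <= g `^ s' by exact: powR_ge0.
have z1 : g `^ s' <= 1.
  by rewrite -(powRr0 g) ltW // powR_lt1 // g0.
have [L [sL hL]] := recode_preimages bq z0 rho0 hq zrho n
  (recode q b (shift (f x0) (digit x0))).
pose LL := [seq nseq j true ++ u | j <- iota 0 m.+1, u <- L].
apply: (le_trans (@hausdorff_content_seq _ s' _ LL
  (fun w => [set y | 0 <= y < 1 /\ starts_with w (digit y)]) _ _)).
  move=> x [Kx hxx0].
  have [u uL [ux _]] := hL _ (hx Kx) (code_separation Kx Kx0 hxx0).
  have x01 : 0 <= x < 1 by case: Kx.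
  have [fm f1 _] := hf x01.
  exists (nseq (f x) true ++ u).
    by apply: allpairs_f => //; rewrite mem_iota leq0n add0n ltnS.
  split=> //; apply: starts_with_cat => k; rewrite ?size_nseq => hk.
    by rewrite nth_nseq hk f1.
  by rewrite -ux.
apply: (@le_trans _ _ (\sum_(w <- LL) ((g `^ s') ^+ size w)%:E)%E).
  apply: lee_sum => w _; rewrite -powR_expr ?(ltW g0) //.
  apply: hausdorff_gauge_le; first exact: ltW.
  apply: diameter_le; first by rewrite exprn_ge0 // ltW.
  by move=> x y [? ?] [? ?]; exact: cylinder_dist.
rewrite sumEFin lee_fin big_allpairs_dep /=.
apply: (@le_trans _ _ (\sum_(j <- iota 0 m.+1) rho ^+ n)); last first.
  by rewrite big_const_seq count_predT size_iota iter_addr_0 mulr_natl.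
apply: ler_sum => j _; apply: le_trans sL; apply: ler_sum => u _.
rewrite size_cat size_nseq exprD ler_piMl ?exprn_ge0 // exprn_ile1 //.
Qed.

End Code.

Lemma survivor_measure_null t s s' : 0 <= s < s' ->
  hausdorff_measure s (bifurcation_set beta `&` [set` `[t, 1]]) = 0%E ->
  hausdorff_measure s' (K t) = 0%E.
Proof.
move=> /andP[s0 ss'] Es.
have s'0 : 0 < s' by lra.
apply: hausdorff_measure_null => //.
have [K0|/set0P K0] := eqVneq (K t) set0; first by rewrite K0 outer_measure0.
have [p Kp pmin] := survivor_min b1 K0.
have p01 : 0 <= p < 1 by case: Kp.
(* The exponent [s1 < s'] gives [rho > z], the room needed for the insertions; [s < s1] is used in
   the final comparison. *)
pose s1 := (s + s') / 2.
pose rho := g `^ s1; pose z := g `^ s'.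
have g01 : 0 < g < 1 by rewrite g0.
have rho0 : 0 < rho by rewrite powR_gt0.
have rho1 : rho < 1 by rewrite -(powRr0 g) powR_lt1 // /s1; lra.
have zrho : z < rho by rewrite powR_lt1 // /s1; lra.
have z0 : 0 < z by rewrite powR_gt0.
(* For [q >= Q] this is the hypothesis [z * rho ^+ q + z ^+ q <= rho ^+ q.+1] of the counting,
   divided by [rho ^+ q]. *)
have [|Q hQ] := @expr_small R (z / rho) (rho - z) _ ltac:(by rewrite subr_gt0).
  by rewrite ltr_pdivrMr // mul1r zrho andbT divr_ge0 // ltW.
have cb := digit_close_zeros b1 b2 bm p01.
have [q [qQ q0 bq zq cq]] := close_zeros_position Q cb.
have [r [qr _ br zr _]] := close_zeros_position q.+1 cb.
have [f hf] := choice digit_first_zero.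
have hq : z * rho ^+ q + z ^+ q <= rho ^+ q.+1.
  have := ltW (hQ q qQ); rewrite expr_div_n ler_pdivrMr ?exprn_gt0 //.
  by rewrite exprS mulrBl lerBrDl.
pose F x := value (code p q r f x).
have gr n : 0 < g ^+ n by rewrite exprn_gt0.
pose c := g ^+ r.+1 * g ^+ r.+2.
have c0 : 0 < c by rewrite mulr_gt0.
apply: (@hausdorff_content_transfer R s s' c (m.+1%:R * c^-1 `^ s) (K t)
  (bifurcation_set beta `&` [set` `[t, 1]]) F) => //.
- by rewrite mulr_ge0 // powR_ge0.
- by move=> _ [x Kx <-]; exact: (value_code Kp pmin q0 qr bq br zq zr cq hf).
move=> U dU.
have [->|/set0P[x0 [Kx0 Ux0]]] := eqVneq (K t `&` F @^-1` U) set0.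
  rewrite outer_measure0 mule_ge0 ?hausdorff_gauge_ge0 //.
  by rewrite lee_fin mulr_ge0 // powR_ge0.
have [D DE] : exists D, diameter U = D%:E.
  exists (fine (diameter U)); rewrite fineK //.
  by rewrite ge0_fin_numE ?diameter_ge0 // (le_lt_trans dU) ?ltry.
rewrite DE lee_fin in dU.
have D0 : 0 <= D by rewrite -lee_fin -DE diameter_ge0.
have bound n : D < g ^+ r.+1 * g ^+ (n + r.+1) ->
    (hausdorff_content s' (K t `&` F @^-1` U) <= (m.+1%:R * rho ^+ n)%:E)%E.
  move=> Dn; apply: le_trans (code_cylinder_content Kp pmin q0 qr bq br zq zr hf
    s'0 (ltW rho0) (ltW zrho) hq n Kx0).
  apply: le_outer_measure => x [Kx Ux]; split=> //; apply: le_lt_trans Dn.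
  by rewrite -lee_fin -DE; exact: le_diameter.
have gaugeU : hausdorff_gauge s U = (D `^ s)%:E.
  rewrite /hausdorff_gauge DE poweR_EFin ifF //.
  by apply/negP => /eqP U0; move: Ux0; rewrite U0.
rewrite gaugeU -EFinM.
(* A set of diameter 0 satisfies [bound] for every [n], so its preimage has content 0. *)
have [Dle|Dgt] := leP D 0.
  apply: (@le_trans _ _ 0%E); last first.
    by rewrite lee_fin !mulr_ge0 ?powR_ge0.
  apply/lee_addgt0Pr => e e0; rewrite add0e.
  have [||N hN] := @expr_small R rho (e / m.+1%:R); [lra | by rewrite divr_gt0 |].
  apply: (le_trans (bound N _)).
    by apply: (le_lt_trans Dle); rewrite mulr_gt0.
  by rewrite lee_fin mulrC -ler_pdivlMr // ltW // hN.
have ex : exists n, c * g ^+ n <= D.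
  have [||N hN] := @expr_small R g (D / c); [lra | by rewrite divr_gt0 |].
  by exists N; rewrite mulrC -ler_pdivlMr // ltW // hN.
(* Minimality of [n] gives the upper bound on [D] required by [bound]; for [n = 0] it comes from
   [D <= c]. *)
case: (ex_minnP ex) => n hn nmin.
apply: (le_trans (bound n _)).
  case: n hn nmin => [|n] hn nmin.
    apply: (le_lt_trans dU); rewrite ltr_pM2l // add0n exprS gtr_pMl //.
  rewrite ltNge; apply/negP => h; have := nmin n; rewrite /c -mulrA -exprD.
  have -> : (r.+2 + n = n.+1 + r.+1)%N by rewrite !addSn !addnS addnC.
  by rewrite h => /(_ erefl); rewrite ltnn.
rewrite lee_fin -mulrA ler_pM2l // -powRM ?invr_ge0 ?(ltW c0) //.
apply: (@le_trans _ _ ((g ^+ n) `^ s)); last first.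
  apply: ge0_ler_powR; rewrite ?nnegrE ?(ltW (gr _)) //.
    by rewrite mulr_ge0 // invr_ge0 ltW.
  by rewrite mulrC ler_pdivlMr // mulrC.
rewrite powR_expr ?(ltW g0) // lerXn2r ?nnegrE ?powR_ge0 //.
by rewrite ltW // powR_lt1 // /s1; lra.
Qed.

End Estimate.

Theorem corollary2 (R : realType) (beta : R) (hbeta : 1 < beta <= 2)
    (hmulti : multinacci beta) (t : R) (ht : 0 <= t < 1) :
  hausdorff_dim (bifurcation_set beta `&` [set` `[t, 1]]) =
  hausdorff_dim (survivor_set beta t).
Proof.
have [m _ [[/andP[b1 b2] bm] _]] := hmulti.
apply/eqP; rewrite eq_le; apply/andP; split; last first.
  by apply: hausdorff_dim_le => s s' ss'; exact: survivor_measure_null bm _ _ _ _.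
(* A point [x >= t] whose orbit stays above [x] survives at level [t]. *)
apply: hausdorff_dim_mono => x []; rewrite bifurcation_setE // => -[hx h].
rewrite /= in_itv /= => /andP[tx _]; split=> // n.
exact: le_trans tx (h n).
Qed.
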